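(* Let $d=2$. For the i.i.d. environment with $\mu(\{e_1,e_2\})=p$ and $\mu(\{-e_1,-e_2\})=1-p$, $\nu$-almost surely all the sets $\mathcal{M}_x$, $x\in\mathbb{Z}^2$, are finite whenever $p>0.83270$ or $p<0.16730$. For the i.i.d. environment with $\mu(\{-e_1,e_1,-e_2\})=p$ and $\mu(\{e_2\})=1-p$, $\nu$-almost surely all the sets $\mathcal{M}_x$, $x\in\mathbb{Z}^2$, are finite whenever $p<0.16730$.
   Context: Let $e_1,e_2$ be the standard basis of $\mathbb{Z}^2$ and $\mathcal{E}=\{\pm e_1,\pm e_2\}$. Given a probability measure $\mu$ on the power set of $\mathcal{E}$ (with $\mu(A)$ short for $\mu(\{A\})$), the environment $\mathcal{G}=(\mathcal{G}_x)_{x\in\mathbb{Z}^2}$ is a family of i.i.d. random subsets of $\mathcal{E}$ with law $\mu$; its law is $\nu=\mu^{\otimes\mathbb{Z}^2}$. Write $x\to y$ if there are $n\ge 0$ and $x=x_0,\dots,x_n=y$ with $x_{i+1}-x_i\in\mathcal{G}_{x_i}$ for $0\le i<n$. Let $\mathcal{M}_x=\{y: x\to y\text{ and }y\to x\}$. *)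

(* Defs.v *)
From HB Require Import structures.
From mathcomp Require Import all_boot all_order all_algebra.
From mathcomp Require Import finmap.
From mathcomp Require Import all_classical all_reals all_analysis.

Set Implicit Arguments.
Unset Strict Implicit.
Unset Printing Implicit Defensive.

Import Order.TTheory GRing.Theory Num.Theory.

Local Open Scope classical_set_scope.
Local Open Scope ring_scope.

Section product_measure.
Context (I : choiceType) (d : measure_display) (T : measurableType d).

Definition coordinate_sets : set_system (I -> T) :=
  \bigcup_i preimage_set_system setT (fun w : I -> T => w i) measurable.

Definition product_space := g_sigma_algebraType coordinate_sets.

HB.instance Definition _ := Measurable.on product_space.

(* [nu] is the product of copies of [mu] indexed by [I]: its values on the
   finite-dimensional rectangles determine it. *)
Definition is_product_measure (R : realType) (mu : probability T R)
    (nu : probability product_space R) : Prop :=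
  forall (J : {fset I}) (A : I -> set T), (forall i, measurable (A i)) ->
    (nu (\bigcap_(i in [set` J]) [set w : product_space | A i (w i)])
     = \prod_(i <- J) mu (A i))%E.

End product_measure.

HB.instance Definition _ (T : finType) := isPointed.Build {set T} (finset.set0).

HB.instance Definition _ (T : finType) :=
  @isMeasurable.Build default_measure_display {set T} discrete_measurable
    discrete_measurable0 discrete_measurableC discrete_measurableU.

Definition site : Type := (int * int)%type.

Definition e1 : site := (1, 0).
Definition e2 : site := (0, 1).

Definition dir : finType := seq_sub [:: e1; - e1; e2; - e2].

(* The set of directions listed in [s]; entries of [s] that are not directions
   are ignored. *)
Definition dirs (s : seq site) : {set dir} :=
  [set u : dir | ssval u \in s]%SET.

Definition environment := product_space site {set dir}.

Section connectivity.
Variable w : environment.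

Definition arrow : rel site :=
  fun x y => [exists u : dir, (u \in w x) && (y - x == ssval u)].

(* [s] lists the points following [x] on a path of length [size s]. *)
Definition leads_to (x y : site) : Prop :=
  exists2 s : seq site, path arrow x s & last x s = y.

Definition communicating (x : site) : set site :=
  [set y | leads_to x y /\ leads_to y x].

End connectivity.

(* Main.v *)
(* A first moment argument along shortest open paths. If y is in M_x then one of
   the paths x -> y, y -> x has nonnegative total height (for a suitable additive
   height h), so it suffices that a.s. only finitely many self-avoiding words s
   of nonnegative height are open from x, or into x. The sites of such a word are
   distinct, so the steps are independent and it is open with probability
   \prod r(u), where r(u) is the probability that u is available at a site; if
   r(u) <= f(u) z^(-h(u)) with z >= 1, this is at most \prod f(u). On the steps of
   nonzero height f is 3/8, slightly above the largest sqrt(p(1-p)).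

   A shortest open word never reverses, and in the orthant environment it has no
   shortcut a b (-a) -> b when a and b are available at the same sites. The number
   of words of length n without these patterns grows like ((3 + sqrt 5)/2)^n, and
   (3 + sqrt 5)/2 * sqrt(p(1-p)) < 1, so the sum over words converges without any
   bound on the connective constant of the square lattice. *)
Require Import Defs.
From mathcomp Require Import all_boot all_order all_algebra.
From mathcomp Require Import finmap lra ring.
From mathcomp Require Import all_classical all_reals all_analysis.

Set Implicit Arguments.
Unset Strict Implicit.
Unset Printing Implicit Defensive.

Import Order.TTheory GRing.Theory Num.Theory.

Local Open Scope classical_set_scope.
Local Open Scope ring_scope.

(** * The four directions *)

Definition east : dir := @SeqSub site [:: e1; - e1; e2; - e2] e1 isT.
Definition west : dir := @SeqSub site [:: e1; - e1; e2; - e2] (- e1) isT.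
Definition north : dir := @SeqSub site [:: e1; - e1; e2; - e2] e2 isT.
Definition south : dir := @SeqSub site [:: e1; - e1; e2; - e2] (- e2) isT.

Lemma dir_cases (P : dir -> Prop) :
  P east -> P west -> P north -> P south -> forall u, P u.
Proof.
move=> Pe Pw Pn Ps u.
have : ssval u \in [:: e1; - e1; e2; - e2] by case: u.
by rewrite !inE => /or4P[] /eqP uE;
  [have -> : u = east | have -> : u = west | have -> : u = north
  | have -> : u = south] => //; apply: val_inj.
Qed.

Lemma big_dir (T : Type) (idx : T) (op : Monoid.com_law idx) (F : dir -> T) :
  \big[op/idx]_(u : dir) F u =
  op (F east) (op (F west) (op (F north) (F south))).
Proof.
rewrite (bigD1 east) //= (bigD1 west) //= (bigD1 north) //= (bigD1 south) //=.
rewrite big_pred0 ?Monoid.mulm1 //.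
by apply: dir_cases.
Qed.

(** * Words of steps, and shortest open words *)

Fixpoint open_word (w : environment) (x : site) (s : seq dir) : bool :=
  if s is u :: s' then (u \in w x) && open_word w (x + ssval u) s' else true.

Definition disp (s : seq dir) : site := \sum_(u <- s) ssval u.

(* The sites at which the steps of [s] start; the endpoint is left out, since
   its environment does not matter. *)
Fixpoint sites (x : site) (s : seq dir) : seq site :=
  if s is u :: s' then x :: sites (x + ssval u) s' else [::].

Lemma disp_cons u s : disp (u :: s) = ssval u + disp s.
Proof. by rewrite /disp big_cons. Qed.

Lemma disp_cat s t : disp (s ++ t) = disp s + disp t.
Proof. by rewrite /disp big_cat. Qed.

Lemma size_sites x s : size (sites x s) = size s.
Proof. by elim: s x => //= u s IHs x; rewrite IHs. Qed.

Lemma mem_sites z x s : z \in sites x s ->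
  exists s1 s2, s = s1 ++ s2 /\ z = x + disp s1.
Proof.
elim: s x => //= u s IHs x; rewrite inE => /orP[/eqP->|/IHs[s1 [s2 [-> ->]]]].
  by exists [::], (u :: s); rewrite /disp big_nil addr0.
by exists (u :: s1), s2; rewrite disp_cons addrA.
Qed.

Lemma open_word_cat w x s t :
  open_word w x (s ++ t) = open_word w x s && open_word w (x + disp s) t.
Proof.
elim: s x => [|u s IHs] x /=; first by rewrite /disp big_nil addr0.
by rewrite IHs disp_cons addrA andbA.
Qed.

Lemma leads_to_open_word w x y : leads_to w x y ->
  exists s, open_word w x s /\ x + disp s = y.
Proof.
move=> [p]; elim: p x => [|z p IHp] x /=.
  by move=> _ <-; exists [::]; rewrite /disp big_nil addr0.
move=> /andP[/existsP[u /andP[uw /eqP zx]] /IHp{IHp} IHp] /IHp[s [ws <-]].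
have xu : x + ssval u = z by rewrite -zx addrC subrK.
by exists (u :: s); rewrite /= uw xu ws disp_cons addrA xu.
Qed.

Definition shortest (w : environment) (x : site) (s : seq dir) : Prop :=
  open_word w x s /\
  forall t, open_word w x t -> disp t = disp s -> (size s <= size t)%N.

Lemma leads_to_shortest w x y : leads_to w x y ->
  exists s, shortest w x s /\ x + disp s = y.
Proof.
move=> /leads_to_open_word[s0 [ws0 <-]].
pose P n := `[< exists s, [/\ open_word w x s, disp s = disp s0 & size s = n] >].
have exP : exists n, P n by exists (size s0); apply/asboolP; exists s0.
have [_ /asboolP[s [ws ds <-]] min_s] := ex_minnP exP.
exists s; rewrite ds; split => //; split => // t wt dt.
by apply: min_s; apply/asboolP; exists t; rewrite dt ds.
Qed.

(** A shorter open replacement of the middle factor with the same displacement leaves the rest of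
    the path in place, so it would shorten the whole word. *)
Lemma shortest_factor w x s1 s2 s3 :
  shortest w x (s1 ++ s2 ++ s3) -> shortest w (x + disp s1) s2.
Proof.
move=> [+ min_s]; rewrite !open_word_cat => /and3P[w1 w2 w3].
split=> // t wt dt.
have := min_s (s1 ++ t ++ s3).
rewrite !open_word_cat w1 wt dt w3 !disp_cat dt !size_cat leq_add2l leq_add2r.
exact.
Qed.

(** A return to [x] closes a loop of zero displacement; as a factor of a shortest word the loop is
    itself shortest, yet the empty word beats it. *)
Lemma shortest_uniq w x s : shortest w x s -> uniq (sites x s).
Proof.
elim: s x => //= u s IHs x us_min; apply/andP; split; last first.
  apply: IHs; have := @shortest_factor w x [:: u] s [::].
  by rewrite cats0 /disp big_seq1; apply.
apply/negP => /mem_sites[s1 [s2 [sE xE]]].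
have := @shortest_factor w x [::] (u :: s1) s2.
rewrite /= -sE => /(_ us_min) [_ us1_min].
suff: (size (u :: s1) <= size (Nil dir))%N by [].
apply: us1_min => //; rewrite {1}/disp big_nil disp_cons.
by apply: (addrI x); rewrite addr0 addrA.
Qed.

(** * Weighted counting of words with forbidden patterns *)

Fixpoint admissible (allowed : dir -> dir -> dir -> bool) (a b : dir)
    (s : seq dir) : bool :=
  if s is c :: s' then allowed a b c && admissible allowed b c s' else true.

Fixpoint words (n : nat) : seq (seq dir) :=
  if n is n'.+1
  then flatten [seq [seq u :: s | s <- words n'] | u <- index_enum dir]
  else [:: [::]].

Lemma mem_words s : s \in words (size s).
Proof.
elim: s => //= u s IHs; apply/flatten_mapP; exists u.
  exact: mem_index_enum.
by rewrite mem_map // => ? ? [].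
Qed.

Section transfer.
Variables (R : realType) (f : dir -> R) (allowed : dir -> dir -> dir -> bool).
Variables (V : dir -> dir -> R) (rho : R).
Hypotheses (f_ge0 : forall u, 0 <= f u) (rho_ge0 : 0 <= rho).
Hypothesis V_ge1 : forall a b, 1 <= V a b.
Hypothesis V_transfer : forall a b,
  \sum_(c : dir) (if allowed a b c then f c * V b c else 0) <= rho * V a b.

(** Here [a] and [b] are the two steps preceding the word. [V] is a supersolution for the transfer
    operator, so each letter peeled off the front costs a factor [rho]; [V_ge1] starts the induction
    at the empty word. *)
Lemma sum_words_le n a b :
  \sum_(s <- words n | admissible allowed a b s) \prod_(u <- s) f u
  <= rho ^+ n * V a b.
Proof.
elim: n a b => [|n IHn] a b /=.
  by rewrite big_cons big_nil /= big_nil addr0 expr0 mul1r.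
rewrite big_flatten big_map exprS.
apply: (@le_trans _ _ (\sum_(c : dir) rho ^+ n *
    (if allowed a b c then f c * V b c else 0))); last first.
  by rewrite -mulr_sumr mulrAC [leRHS]mulrC ler_wpM2l ?exprn_ge0.
apply: ler_sum => c _; rewrite big_map /=.
case: ifP => ac; last by rewrite big_pred0 ?mulr0 // => s; rewrite ac.
under eq_bigr do rewrite big_cons.
rewrite -mulr_sumr mulrCA; apply: ler_wpM2l => //; exact: IHn.
Qed.

End transfer.

(** * Union bound, Borel-Cantelli and countable intersections *)

Lemma measure_bigsetU_le d (T : measurableType d) (R : realType)
    (mu : {measure set T -> \bar R}) (I : Type) (r : seq I) (P : pred I)
    (F : I -> set T) : (forall i, measurable (F i)) ->
  (mu (\big[setU/set0]_(i <- r | P i) F i) <= \sum_(i <- r | P i) mu (F i))%E.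
Proof.
move=> mF; elim: r => [|i r IHr]; first by rewrite !big_nil measure0.
rewrite !big_cons; case: ifP => // _.
have mr : measurable (\big[setU/set0]_(j <- r | P j) F j).
  by apply: bigsetU_measurable.
by apply: le_trans (measureU2 mu (mF i) mr) _; rewrite leeD2l.
Qed.

Lemma lim_sup_set_geometric0 d (T : measurableType d) (R : realType)
    (mu : {measure set T -> \bar R}) (F : (set T)^nat) (K rho : R) :
  0 <= rho < 1 -> (forall n, measurable (F n)) ->
  (forall n, mu (F n) <= (K * rho ^+ n)%:E)%E -> mu (lim_sup_set F) = 0%E.
Proof.
move=> /andP[rho0 rho1] mF F_le; apply: lim_sup_set_cvg0 => //.
have rho_lt1 : `|rho| < 1 by rewrite ger0_norm.
apply: (@le_lt_trans _ _ (\sum_(0 <= n <oo) (geometric K rho n)%:E)%E).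
  by apply: lee_nneseries => n *; [exact: measure_ge0|exact: F_le].
have -> : (fun n => \sum_(0 <= k < n) (geometric K rho k)%:E)%E =
    EFin \o series (geometric K rho).
  by apply/funext => n; rewrite sumEFin.
by rewrite EFin_lim ?ltry //; exact: is_cvg_geometric_series.
Qed.

Lemma ae_forall_countable d (T : measurableType d) (R : realType)
    (mu : {measure set T -> \bar R}) (I : countType) (P : I -> T -> Prop) :
  (forall i, {ae mu, forall t, P i t}) -> {ae mu, forall t, forall i, P i t}.
Proof.
move=> aeP.
have : {ae mu, forall t, forall k : nat, forall i,
    @choice.unpickle I k = Some i -> P i t}.
  apply: ae_foralln => k; case: (@choice.unpickle I k) => [i|]; last exact: aeW.
  by apply: filterS (aeP i) => t Pt j [<-].
by apply: filterS => t Pt i; apply: (Pt (choice.pickle i)); rewrite choice.pickleK.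
Qed.

(** * Measurability and independence of the steps of a word *)

Lemma measurable_site (x : site) (A : set {set dir}) :
  measurable [set w : environment | A (w x)].
Proof.
apply: sub_sigma_algebra; exists x => //; exists A => //.
by rewrite setTI.
Qed.

Lemma measurable_open_word x s :
  measurable [set w : environment | open_word w x s].
Proof.
elim: s x => [|u s IHs] x /=.
  by rewrite (_ : [set _ | _] = setT) //; apply/seteqP.
have := measurableI _ _ (measurable_site x [set B : {set dir} | u \in B])
  (IHs (x + ssval u)).
by rewrite (_ : _ `&` _ = [set w : environment |
    (u \in w x) && open_word w (x + ssval u) s]) //;
  apply/seteqP; split => w /= /andP.
Qed.

Lemma open_wordE (L : site -> dir) w x s : map L (sites x s) = s ->
  open_word w x s = all (fun z => L z \in w z) (sites x s).
Proof. by elim: s x => //= u s IHs x [-> /IHs ->]. Qed.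

(** On distinct sites the letters of a word become a function of the site, the form in which
    [is_product_measure] takes its events. *)
Lemma uniq_labelling (T : eqType) (U : Type) (u0 : U) (zs : seq T) (s : seq U) :
  uniq zs -> size zs = size s -> exists L : T -> U, map L zs = s.
Proof.
elim: zs s => [|z zs IHzs] [|u s] //=.
move=> /andP[z_notin uzs] [/(IHzs _ uzs)[L LE]].
exists (fun y => if y == z then u else L y); rewrite eqxx -LE; congr cons.
apply/eq_in_map => y y_in; case: eqP => // yz.
by rewrite yz (negbTE z_notin) in y_in.
Qed.

Definition opens (u : dir) : set {set dir} := [set B : {set dir} | u \in B].

(** * The first moment bound and finiteness of the communicating classes *)

Section first_moment.
Variables (R : realType) (mu : probability {set dir} R).
Variables (nu : probability environment R) (hnu : is_product_measure mu nu).

Lemma prob_open_word x s : uniq (sites x s) ->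
  nu [set w : environment | open_word w x s]
  = (\prod_(u <- s) mu (opens u))%E.
Proof.
move=> us.
have [L LE] := uniq_labelling east us (size_sites x s).
have := hnu [fset z in sites x s]%fset (A := fun z => opens (L z)).
move=> /(_ (fun=> I)) nuE.
rewrite -[in RHS]LE big_map.
transitivity (\prod_(z <- [fset z in sites x s]%fset) mu (opens (L z)))%E;
  last first.
  apply: perm_big; apply: uniq_perm; rewrite ?fset_uniq // => z.
  by rewrite inE.
rewrite -nuE; congr (nu _); apply/seteqP; split => w /=.
  rewrite (open_wordE _ LE) => /allP ws z /=; rewrite inE; exact: ws.
rewrite (open_wordE _ LE) => ws; apply/allP => z zs.
by apply: (ws z); rewrite /= inE.
Qed.

Lemma prob_site x (A : set {set dir}) :
  nu [set w : environment | A (w x)] = mu A.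
Proof.
have := hnu [fset x]%fset (A := fun=> A) (fun=> I).
rewrite big_seq_fset1 => <-; congr (nu _); apply/seteqP; split => w /=.
  by move=> Aw z /=; rewrite inE => /eqP ->.
by move=> /(_ x); apply; rewrite /= inE.
Qed.

Variables (f : dir -> R) (h : site -> int) (z : R).
Hypotheses (f_ge0 : forall u, 0 <= f u) (z_ge1 : 1 <= z).
Hypothesis hD : {morph h : x y / x + y}.
Hypothesis mu_opens_le : forall u,
  (mu (opens u) <= (f u * z ^ (- h (ssval u)))%:E)%E.

(** By additivity of [h] the tilting factors multiply to [z ^ (- h (disp s))], which is at most 1
    because [z >= 1] and the total height is nonnegative. *)
Lemma prob_open_word_le x s : uniq (sites x s) -> 0 <= h (disp s) ->
  (nu [set w : environment | open_word w x s] <= (\prod_(u <- s) f u)%:E)%E.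
Proof.
move=> us hs; have z_gt0 : 0 < z by exact: lt_le_trans z_ge1.
rewrite prob_open_word //.
apply: (@le_trans _ _ (\prod_(u <- s) f u * z ^ (- h (disp s)))%:E); last first.
  rewrite lee_fin ler_piMr ?prodr_ge0 // -exprz_inv.
  case: (h _) hs => // n _; rewrite -exprnP.
  by rewrite exprn_ile1 ?invr_ge0 ?(ltW z_gt0) // invf_le1.
have h0 : h 0 = 0 by apply: (addrI (h 0)); rewrite -hD !addr0.
elim: s {us hs} => [|u s IHs]; first by rewrite /disp !big_nil h0 oppr0 expr0z mulr1.
rewrite !big_cons disp_cons hD opprD expfzDr ?gt_eqF // mulrACA EFinM.
apply: lee_pmul => //.
by apply: prode_ge0 => v _; exact: measure_ge0.
Qed.

Variables (allowed : dir -> dir -> dir -> bool) (V : dir -> dir -> R) (rho : R).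
Hypotheses (rho_ge0 : 0 <= rho) (rho_lt1 : rho < 1).
Hypothesis V_ge1 : forall a b, 1 <= V a b.
Hypothesis V_transfer : forall a b,
  \sum_(c : dir) (if allowed a b c then f c * V b c else 0) <= rho * V a b.

(** The empty event for words that revisit a site lets the probability bound hold without a side
    condition on [s]. *)
Definition self_avoiding_open (x : site) (s : seq dir) : set environment :=
  if uniq (sites x s) then [set w : environment | open_word w x s] else set0.

(** The pair [c c] is a fictitious past for the word; [shortest_admissible] takes the first letter
    of the word for [c]. *)
Definition candidates (n : nat) (c : dir) : seq (seq dir) :=
  [seq s <- words n | admissible allowed c c s && (0 <= h (disp s))].

(** Each word is placed twice, starting at [x] and ending at [x], since either the path leaving [x]
    or the one returning to it may be the one of nonnegative height. *)
Definition long_path (x : site) (n : nat) : set environment :=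
  \big[setU/set0]_(c : dir) \big[setU/set0]_(s <- candidates n c)
    (self_avoiding_open x s `|` self_avoiding_open (x - disp s) s).

Lemma measurable_self_avoiding_open x s : measurable (self_avoiding_open x s).
Proof.
by rewrite /self_avoiding_open; case: ifP => // _; exact: measurable_open_word.
Qed.

Lemma measurable_long_path x n : measurable (long_path x n).
Proof.
apply: bigsetU_measurable => c _; apply: bigsetU_measurable => s _.
by apply: measurableU; exact: measurable_self_avoiding_open.
Qed.

Lemma prob_self_avoiding_open_le x s : 0 <= h (disp s) ->
  (nu (self_avoiding_open x s) <= (\prod_(u <- s) f u)%:E)%E.
Proof.
move=> hs; rewrite /self_avoiding_open; case: ifP => us.
  exact: prob_open_word_le.
by rewrite measure0 lee_fin prodr_ge0.
Qed.

Lemma prob_long_path_le x n :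
  (nu (long_path x n) <= ((2 * \sum_(c : dir) V c c) * rho ^+ n)%:E)%E.
Proof.
apply: (@le_trans _ _ (\sum_(c : dir) (2 * (rho ^+ n * V c c))%:E)%E).
  apply: le_trans (measure_bigsetU_le _ _ _ _) _ => [c|].
    apply: bigsetU_measurable => s _.
    by apply: measurableU; exact: measurable_self_avoiding_open.
  apply: lee_sum => c _.
  apply: le_trans (measure_bigsetU_le _ _ _ _) _ => [s|].
    by apply: measurableU; exact: measurable_self_avoiding_open.
  apply: (@le_trans _ _ (\sum_(s <- candidates n c)
      (2 * \prod_(u <- s) f u)%:E)%E).
    rewrite big_seq [leRHS]big_seq; apply: lee_sum => s.
    rewrite mem_filter => /andP[/andP[_ hs] _].
    apply: le_trans (measureU2 _ _ _) _; try exact: measurable_self_avoiding_open.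
    by rewrite mulr2n mulrDl !mul1r EFinD leeD // prob_self_avoiding_open_le.
  rewrite sumEFin lee_fin -mulr_sumr ler_wpM2l // big_filter.
  apply: le_trans _ (sum_words_le f_ge0 rho_ge0 V_ge1 V_transfer n c c).
  (* Dropping the height condition only adds nonnegative terms. *)
  rewrite big_mkcond [leRHS]big_mkcond; apply: ler_sum => s _.
  by case: (admissible _ _ _ _) => //=; case: ifP => // _; exact: prodr_ge0.
rewrite sumEFin lee_fin -mulr_sumr -mulr_sumr.
by rewrite -mulrA [_ * rho ^+ n]mulrC.
Qed.

Lemma ae_finitely_many_long_paths :
  {ae nu, forall w, forall x, ~ lim_sup_set (long_path x) w}.
Proof.
apply: ae_forall_countable => x.
have null := lim_sup_set_geometric0 (mu := nu) (F := long_path x)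
  (introT andP (conj rho_ge0 rho_lt1)) (measurable_long_path x)
  (prob_long_path_le x).
exists (lim_sup_set (long_path x)); split => //.
  apply: bigcap_measurable => // n _; apply: bigcup_measurable => m _.
  exact: measurable_long_path.
by move=> w /= /contrapT.
Qed.

Variable D : set {set dir}.
Hypothesis mu_D : mu (~` D) = 0%E.
Hypothesis allowed_refl : forall c, allowed c c c.
Hypothesis allowed_start : forall w x a b, (forall y, D (w y)) ->
  shortest w x [:: a; b] -> allowed a a b.
Hypothesis allowed_shortest : forall w x a b c, (forall y, D (w y)) ->
  shortest w x [:: a; b; c] -> allowed a b c.

(** With the first letter repeated as past, [allowed_refl] covers the first letter, [allowed_start]
    the second, and [allowed_shortest] all later ones. *)
Lemma shortest_admissible w x s : (forall y, D (w y)) -> shortest w x s ->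
  exists c, admissible allowed c c s.
Proof.
move=> Dw; case: s => [|a [|b s]] sp; first by exists east.
  by exists a; rewrite /= allowed_refl.
exists a; rewrite /= allowed_refl /=.
have -> /= : allowed a a b.
  apply: (allowed_start Dw (x := x + 0)).
  by have := @shortest_factor w x [::] [:: a; b] s; rewrite /disp big_nil; apply.
elim: s a b x sp => //= c s IHs a b x sp; apply/andP; split.
  apply: (allowed_shortest Dw (x := x + 0)).
  by have := @shortest_factor w x [::] [:: a; b; c] s; rewrite /disp big_nil; apply.
apply: (IHs b c (x + disp [:: a])).
by have := @shortest_factor w x [:: a] [:: b, c & s] [::]; rewrite cats0; apply.
Qed.

Lemma ae_support : {ae nu, forall w, forall y, D (w y)}.
Proof.
apply: ae_forall_countable => y.
exists [set w : environment | (~` D) (w y)]; split => //.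
  exact: measurable_site.
exact: etrans (prob_site y (~` D)) mu_D.
Qed.

Lemma long_path_shortest w x y s : (forall z, D (w z)) -> shortest w y s ->
  0 <= h (disp s) -> x = y \/ x = y + disp s -> long_path x (size s) w.
Proof.
move=> Dw sp hs xE; have [c cs] := shortest_admissible Dw sp.
rewrite /long_path -bigcup_seq; exists c => /=; first exact: mem_index_enum.
rewrite -bigcup_seq; exists s; first by rewrite /= mem_filter cs hs mem_words.
have ow : self_avoiding_open y s w.
  by rewrite /self_avoiding_open (shortest_uniq sp); case: sp.
by case: xE => ->; [left|right; rewrite addrK].
Qed.

Lemma ae_finite_communicating :
  {ae nu, forall w, forall x : site, finite_set (communicating w x)}.
Proof.
apply: (filterS2 (ae_filter_ringOfSetsType nu) _ ae_support
  ae_finitely_many_long_paths) => w Dw Lw x.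
(* From length [N] on, no candidate word is open from [x] or into [x]. *)
have /existsNP[N /not_implyP[_ noN]] := Lw x.
have short y s : shortest w y s -> 0 <= h (disp s) ->
    x = y \/ x = y + disp s -> (size s < N)%N.
  move=> sp hs xE; rewrite ltnNge; apply/negP => Ns; apply: noN.
  by exists (size s) => //; exact: (long_path_shortest Dw sp).
pose short_words := flatten [seq words n | n <- iota 0 N].
have mem_short s : (size s < N)%N -> s \in short_words.
  move=> sN; apply/flatten_mapP; exists (size s); last exact: mem_words.
  by rewrite mem_iota add0n.
apply: (@sub_finite_set _ _ [set` [seq x + disp s | s <- short_words] ++
    [seq x - disp s | s <- short_words]]); last exact: finite_seq.
move=> y [/leads_to_shortest[s [sp sE]] /leads_to_shortest[t [tp tE]]] /=.
have h0 : h 0 = 0 by apply: (addrI (h 0)); rewrite -hD !addr0.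
(* The two displacements cancel, so one of the two heights is nonnegative; that path is short and
   determines [y] as [x + disp s] or [x - disp t]. *)
have st : disp s + disp t = 0.
  by apply: (addrI x); rewrite addr0 addrA sE tE.
rewrite mem_cat; case: (leP 0 (h (disp s))) => hs.
  apply/orP; left; apply/mapP; exists s => //.
  by apply/mem_short/(short x) => //; left.
have ht : 0 <= h (disp t).
  have := hD (disp s) (disp t); rewrite st h0 => /eqP.
  by rewrite eq_sym addrC addr_eq0 => /eqP ->; rewrite oppr_ge0 ltW.
apply/orP; right; apply/mapP; exists t; last by rewrite -tE addrK.
by apply/mem_short/(short y) => //; right.
Qed.

End first_moment.

(** * Environments with two possible values *)

Section two_point_law.
Variables (R : realType) (mu : probability {set dir} R) (p : R).
Variables (A B : {set dir}).
Hypotheses (AB : A != B).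
Hypotheses (muA : mu [set A] = p%:E) (muB : mu [set B] = (1 - p)%:E).

Lemma two_point_support : mu (~` [set A; B]) = 0%E.
Proof.
have AB0 : [set A] `&` [set B] = set0.
  by apply/seteqP; split => // C [/= -> BA]; move: AB; rewrite BA eqxx.
have muAB : mu [set A; B] = (mu [set A] + mu [set B])%E by exact: measureU.
by rewrite probability_setC // muAB muA muB -EFinD [p + _]addrC subrK subrr.
Qed.

(** Up to a null set, [u] is available only through those of the two atoms that contain it. *)
Lemma two_point_opens_le u :
  (mu (opens u) <=
   ((if u \in A then p else 0) + (if u \in B then 1 - p else 0))%:E)%E.
Proof.
have sub : opens u `<=` ~` [set A; B] `|`
    ((if u \in A then [set A] else set0) `|` (if u \in B then [set B] else set0)).
  move=> C uC; have [[CA|CB]|] := pselect ([set A; B] C); last by left.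
    by right; left; rewrite -CA ifT.
  by right; right; rewrite -CB ifT.
apply: le_trans (le_measure mu _ _ sub) _; rewrite ?inE //.
apply: le_trans (measureU2 mu _ _) _ => //.
rewrite [X in (X + _)%E]two_point_support add0e.
apply: le_trans (measureU2 mu _ _) _ => //.
by rewrite EFinD leeD //; case: ifP => _; rewrite ?measure0 -?muA -?muB.
Qed.

End two_point_law.

(** * Forbidden patterns and numerical transfer bounds *)

Definition reversing (b c : dir) : bool := ssval c == - ssval b.

Lemma shortest_not_reversing w x b c :
  shortest w x [:: b; c] -> ~~ reversing b c.
Proof.
move=> [_ min_bc]; apply/negP => /eqP bc.
have := min_bc [::] isT; rewrite /disp big_nil !big_cons big_nil bc addr0 subrr.
by move=> /(_ erefl).
Qed.

Definition height (v : site) : int := v.1 + v.2.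

Lemma heightD : {morph height : u v / u + v}.
Proof. by move=> u v; rewrite /height /= addrACA. Qed.

(* At a site where [a] and [b] are both available, the three steps [a b (-a)]
   can be replaced by the single step [b]. *)
Definition orthant_allowed (a b c : dir) : bool :=
  ~~ reversing b c &&
  ~~ (reversing a c && (height (ssval a) == height (ssval b))).

(* (13, 8) approximates the Perron eigenvector (golden ratio, 1) of the transfer
   matrix; the weight 3/8 per step times 21/8 is 63/64. *)
Definition orthant_potential (a b : dir) : nat :=
  if (a != b) && (height (ssval a) == height (ssval b)) then 8 else 13.

(** After two distinct steps of equal height two continuations remain, and 8 + 13 = 21 gives
    equality. Otherwise three remain, and 8 * (13 + 8 + 13) = 272 is just below 21 * 13 = 273. *)
Lemma orthant_transfer a b :
  (8 * \sum_(c : dir) (if orthant_allowed a b c then orthant_potential b c else 0)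
   <= 21 * orthant_potential a b)%N.
Proof. by rewrite big_dir; move: a b; do 2 apply: dir_cases. Qed.

(** The four weights sum to 6, and the excluded reversal weighs at least 1. *)
Lemma nonreversing_transfer b :
  (\sum_(c : dir) (if ~~ reversing b c then
     (if (ssval c).2 == 0 then 1 else 2) else 0) <= 5)%N.
Proof. by rewrite big_dir; move: b; apply: dir_cases. Qed.

(** Since 9/64 is the square of 3/8, the tilt [8 / 3 * a] that gives a step of probability [a] the
    weight 3/8 also serves the opposite step, of probability [b]. *)
Lemma le_tilted (R : realFieldType) (a b : R) :
  0 < a -> a * b <= 9 / 64 -> b <= 3 / 8 * (8 / 3 * a)^-1.
Proof. by move=> a_gt0 ab; rewrite ler_pdivlMr; [lra|rewrite mulr_gt0]. Qed.

(** * The two models *)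

Lemma ae_finite_orthant (R : realType) (p : R) (mu : probability {set dir} R)
    (nu : probability environment R) :
  is_product_measure mu nu ->
  mu [set dirs [:: e1; e2]] = p%:E ->
  mu [set dirs [:: - e1; - e2]] = (1 - p)%:E ->
  p * (1 - p) <= 9 / 64 -> 3 / 8 <= p \/ 3 / 8 <= 1 - p ->
  {ae nu, forall w, forall x : site, finite_set (communicating w x)}.
Proof.
move=> hnu muA muB p_le p_large.
have AB : dirs [:: e1; e2] != dirs [:: - e1; - e2].
  by apply/eqP => /setP/(_ east); rewrite !inE.
have opens_le := two_point_opens_le AB muA muB.
have [h [z [hD z1 h_le]]] : exists (h : site -> int) (z : R),
    [/\ {morph h : u v / u + v}, 1 <= z & forall u,
     (mu (opens u) <= (3 / 8 * z ^ (- h (ssval u)))%:E)%E].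
  (* The sign of [h] makes steps of the atom with probability at least 3/8 descend, so a word of
     nonnegative height has at least as many steps of the other kind. *)
  case: p_large => q_large.
    exists (fun v => - height v), (8 / 3 * p); split; first last.
    - move=> u; apply: le_trans (opens_le u) _; rewrite lee_fin.
      move: u; apply: dir_cases; rewrite !inE /=.
      * by rewrite (_ : - - height e1 = 1) // expr1z; lra.
      * by rewrite (_ : - - height (- e1) = -1) // exprN1 add0r le_tilted //; lra.
      * by rewrite (_ : - - height e2 = 1) // expr1z; lra.
      * by rewrite (_ : - - height (- e2) = -1) // exprN1 add0r le_tilted //; lra.
    - lra.
    - by move=> u v; rewrite heightD opprD.
  exists height, (8 / 3 * (1 - p)); split; [exact: heightD|lra|] => u.
  apply: le_trans (opens_le u) _; rewrite lee_fin.
  move: u; apply: dir_cases; rewrite !inE /=.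
  - by rewrite (_ : - height e1 = -1) // exprN1 addr0 le_tilted //; lra.
  - by rewrite (_ : - height (- e1) = 1) // expr1z; lra.
  - by rewrite (_ : - height e2 = -1) // exprN1 addr0 le_tilted //; lra.
  - by rewrite (_ : - height (- e2) = 1) // expr1z; lra.
pose V a b : R := (orthant_potential a b)%:R.
apply: (@ae_finite_communicating _ mu nu hnu (fun=> 3 / 8) h z _ _ _ _
  orthant_allowed V (63 / 64) _ _ _ _
  [set dirs [:: e1; e2]; dirs [:: - e1; - e2]]) => //.
- lra.
- by move=> a b; rewrite /V /orthant_potential; case: ifP => _; rewrite ler1n.
- move=> a b.
  have transfer : 8 * (\sum_c (if orthant_allowed a b c
      then orthant_potential b c else 0%N)%:R) <= 21 * V a b.
    by rewrite -natr_sum -!natrM ler_nat orthant_transfer.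
  have -> : \sum_c (if orthant_allowed a b c then 3 / 8 * V b c else 0) =
      3 / 8 * (\sum_c (if orthant_allowed a b c
      then orthant_potential b c else 0%N)%:R).
    by rewrite mulr_sumr; apply: eq_bigr => c _; case: ifP; rewrite ?mulr0.
  lra.
- exact: (two_point_support AB muA muB).
- by apply: dir_cases.
- move=> w x a b _ /shortest_not_reversing ab.
  by rewrite /orthant_allowed (negbTE ab).
move=> w x a b c Dw abc; rewrite /orthant_allowed; apply/andP; split.
  apply: (@shortest_not_reversing w (x + disp [:: a])).
  by have := @shortest_factor w x [:: a] [:: b; c] [::]; rewrite cats0; apply.
apply/negP => /andP[/eqP ac /eqP ab]; case: abc => wabc min_abc.
(* Steps of equal height lie in the same atom, so [b] is available wherever [a] is; the single step
   [b] then has the displacement of [a b (-a)]. *)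
have bw : b \in w x.
  move: wabc => /= /andP[aw _]; case: (Dw x) aw => /= ->; rewrite !inE.
    by move: a b ab {ac min_abc}; do 2 apply: dir_cases.
  by move: a b ab {ac min_abc}; do 2 apply: dir_cases.
have /= := min_abc [:: b]; rewrite bw /disp big_seq1 !big_cons big_nil ac addr0.
by rewrite addrC subrK => /(_ isT erefl).
Qed.

Lemma ae_finite_half_orthant (R : realType) (p : R) (mu : probability {set dir} R)
    (nu : probability environment R) :
  is_product_measure mu nu ->
  mu [set dirs [:: - e1; e1; - e2]] = p%:E ->
  mu [set dirs [:: e2]] = (1 - p)%:E ->
  p * (1 - p) <= 9 / 64 -> p <= 3 / 16 ->
  {ae nu, forall w, forall x : site, finite_set (communicating w x)}.
Proof.
move=> hnu muA muB pq_le p_small.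
have AB : dirs [:: - e1; e1; - e2] != dirs [:: e2].
  by apply/eqP => /setP/(_ east); rewrite !inE.
have opens_le := two_point_opens_le AB muA muB.
(* Horizontal steps have height 0 and probability at most [p <= 3 / 16]; vertical ones get 3/8 after
   tilting, with north, the likely one, descending. By [nonreversing_transfer] the growth rate is at
   most 5 * 3/16 = 15/16. *)
pose f (u : dir) : R := 3 / 16 * (if (ssval u).2 == 0 then 1%N else 2%N)%:R.
apply: (@ae_finite_communicating _ mu nu hnu f (fun v => - v.2) (8 / 3 * (1 - p))
  _ _ _ _ (fun _ b c => ~~ reversing b c) (fun _ _ => 1) (15 / 16) _ _ _ _
  setT) => //.
- by move=> u; rewrite /f mulr_ge0 ?ler0n //; lra.
- lra.
- by move=> u v; rewrite /= opprD.
- move=> u; apply: le_trans (opens_le u) _; rewrite lee_fin /f.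
  move: u; apply: dir_cases; rewrite !inE /=.
  - by rewrite !oppr0 expr0z; lra.
  - by rewrite !oppr0 expr0z; lra.
  - by rewrite opprK expr1z; lra.
  - have -> : 3 / 16 * 2 = 3 / 8 :> R by field.
    by rewrite opprK exprN1 addr0 le_tilted //; lra.
- lra.
- move=> _ b.
  have transfer : (\sum_c (if ~~ reversing b c then
      if (ssval c).2 == 0 then 1%N else 2%N else 0%N)%:R) <= 5 :> R.
    by rewrite -natr_sum ler_nat nonreversing_transfer.
  have -> : \sum_c (if ~~ reversing b c then f c * 1 else 0) =
      3 / 16 * (\sum_c (if ~~ reversing b c then
      if (ssval c).2 == 0 then 1%N else 2%N else 0%N)%:R).
    by rewrite mulr_sumr; apply: eq_bigr => c _; case: ifP; rewrite ?mulr0 ?mulr1.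
  lra.
- by rewrite setCT measure0.
- by apply: dir_cases.
- by move=> w x a b _ /shortest_not_reversing.
- move=> w x a b c _ abc.
  apply: (@shortest_not_reversing w (x + disp [:: a])).
  by have := @shortest_factor w x [:: a] [:: b; c] [::]; rewrite cats0; apply.
Qed.

Theorem corollary4p3 (R : realType) (p : R) (mu : probability {set dir} R)
    (nu : probability environment R) (hnu : is_product_measure mu nu) :
  (mu [set dirs [:: e1; e2]] = p%:E ->
   mu [set dirs [:: - e1; - e2]] = (1 - p)%:E ->
   83270%:R / 100000%:R < p \/ p < 16730%:R / 100000%:R ->
   {ae nu, forall w, forall x : site, finite_set (communicating w x)})
  /\
  (mu [set dirs [:: - e1; e1; - e2]] = p%:E ->
   mu [set dirs [:: e2]] = (1 - p)%:E ->
   p < 16730%:R / 100000%:R ->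
   {ae nu, forall w, forall x : site, finite_set (communicating w x)}).
Proof.
split=> muA muB p_bound.
  apply: (ae_finite_orthant hnu muA muB).
    (* At the threshold 0.16730 * 0.83270 is about 0.1393, below 9/64 = 0.140625, and [p * (1 - p)]
       decreases as [p] moves away from 1/2. *)
    by case: p_bound => p_bound; nra.
  by case: p_bound => p_bound; [left|right]; lra.
by apply: (ae_finite_half_orthant hnu muA muB); [nra|lra].
Qed.
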